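(* There is a closed graph $G$ on the Cantor space $2^\omega$ without isolated vertices (in the sense of graph theory) such that $G$ contains a dense induced copy of the random graph $\mathbf R$, i.e. there is a dense subset of $2^\omega$ which, as an induced subgraph of $G$, is isomorphic to $\mathbf R$. In particular, every countable graph embeds into a closed graph on $2^\omega$.
   Context: A graph is a pair $(V,E)$ where $E$ is a symmetric and reflexive binary relation on $V$ (every vertex has a loop). A closed graph on a topological space $X$ is a graph with vertex set $X$ whose edge relation is a closed subset of $X\times X$. A vertex is isolated (in the graph-theoretic sense) if it is adjacent only to itself. An embedding of graphs is an isomorphism onto an induced subgraph. $\mathbf R$ is the random graph: the unique (up to isomorphism) countable graph such that for all disjoint finite $A,B\subseteq\mathbf R$ there is a vertex in $\mathbf R\setminus(A\cup B)$ adjacent to all elements of $A$ and to no element of $B$. *)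

(* Defs.v *)
From mathcomp Require Import all_boot.
From mathcomp Require Import all_classical.
From mathcomp Require Import topology cantor.

Set Implicit Arguments.
Unset Strict Implicit.
Unset Printing Implicit Defensive.

Local Open Scope classical_set_scope.

Record graph (V : Type) := Graph {
  adj :> V -> V -> Prop;
  adj_refl : forall x, adj x x;
  adj_sym : forall x y, adj x y -> adj y x }.

Definition closed_graph (X : topologicalType) (G : graph X) : Prop :=
  closed [set p : X * X | G p.1 p.2].

(* Adjacent only to itself; unrelated to isolated points of a topology. *)
Definition isolated_vertex (V : Type) (G : graph V) (x : V) : Prop :=
  forall y, G x y -> y = x.

Definition induced (V : Type) (G : graph V) (D : set V) : graph D :=
  {| adj := fun x y : D => G (val x) (val y);
     adj_refl := fun x => adj_refl G (val x);
     adj_sym := fun x y => @adj_sym V G (val x) (val y) |}.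

Definition isomorphic (V W : Type) (G : graph V) (H : graph W) : Prop :=
  exists f : V -> W, bijective f /\ forall x y, G x y <-> H (f x) (f y).

Definition embeds (V W : Type) (G : graph V) (H : graph W) : Prop :=
  exists D : set W, isomorphic G (induced H D).

Definition countable_graph (V : Type) (_ : graph V) : Prop :=
  countable [set: V].

(* This determines a graph up to isomorphism, so "the" random graph is any
   graph with this property; [random_graph_exists] provides one. *)
Definition is_random_graph (V : Type) (R : graph V) : Prop :=
  countable_graph R /\
  forall A B : set V, finite_set A -> finite_set B -> A `&` B = set0 ->
    exists v, [/\ ~ (A `|` B) v,
                  forall a, A a -> R v a &
                  forall b, B b -> ~ R v b].

(* Rado's graph on nat: distinct x and y are adjacent when one of them occurs
   in the finite sequence coded by the other. *)
Definition rado_adj (x y : nat) : Prop :=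
  [|| x == y, x \in CodeSeq.decode y | y \in CodeSeq.decode x].

Lemma rado_adj_refl x : rado_adj x x.
Proof. by rewrite /rado_adj eqxx. Qed.

Lemma rado_adj_sym x y : rado_adj x y -> rado_adj y x.
Proof. by rewrite /rado_adj eq_sym [X in _ || X]orbC. Qed.

Definition rado : graph nat := Graph rado_adj_refl rado_adj_sym.

Lemma rado_is_random_graph : is_random_graph rado.
Proof.
split=> [|A B /finite_seqP[s ->] /finite_seqP[t ->] st0]; first exact: countableP.
pose m := (\max_(i <- s ++ t) i).+1.
have ltm i : i \in s ++ t -> (i < m)%N.
  by move=> ist; rewrite ltnS; apply: (leq_bigmax_seq (F := id)).
pose y := CodeSeq.code (rcons s m).
have decy : CodeSeq.decode y = rcons s m by exact: CodeSeq.codeK.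
have lty i : i \in s ++ t -> (i < y)%N.
  move=> /ltm im; apply: (ltn_trans im).
  by apply: (allP (CodeSeq.ltn_code _)); rewrite mem_rcons mem_head.
exists y; split=> [yst|a /= sa|b /= tb].
- by have := lty y; rewrite mem_cat ltnn; case: yst => /= ->; rewrite ?orbT => /(_ isT).
- by rewrite /rado_adj decy mem_rcons inE sa !orbT.
- have bst : b \in s ++ t by rewrite mem_cat tb orbT.
  rewrite /rado_adj decy mem_rcons inE => /or3P[/eqP yb|yb|/orP[/eqP bm|bs]].
  + by have := lty b bst; rewrite yb ltnn.
  + have /= := allP (CodeSeq.gtn_decode b) y yb.
    by rewrite ltnNge (ltnW (lty b bst)).
  + by have := ltm b bst; rewrite bm ltnn.
  + have : ([set` s] `&` [set` t]) b by split.
    by rewrite st0.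
Qed.

Lemma random_graph_exists : exists (V : Type) (R : graph V), is_random_graph R.
Proof. by exists nat, rado; exact: rado_is_random_graph. Qed.

(* Main.v *)
(* The eventually zero sequences form a dense set D, and only the open relation
   of non-adjacency has to be specified.  Rado's coding does it: if k codes a
   finite list of finite sets b, the cylinder [1^k 0] is made non-adjacent to
   the cylinders [b|k] for all b in the list.  To be adjacent to a finite A in D
   and to no point of a finite B in D, take v = 1^k 0 0 0 ... where k codes B
   together with one dummy set, which only serves to make k exceed the supports
   of all points of A and B.  No cylinder used contains 1 1 1 ..., which is
   therefore adjacent to everything.  Back-and-forth identifies D with any given
   random graph. *)
Require Import Defs.
From mathcomp Require Import all_boot.
From mathcomp Require Import all_classical.
From mathcomp Require Import topology cantor.

Set Implicit Arguments.
Unset Strict Implicit.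
Unset Printing Implicit Defensive.

Local Open Scope classical_set_scope.

(** * Cylinders and the eventually zero sequences *)

Definition agree (k : nat) (x y : cantor_space) : Prop :=
  forall i, i < k -> x i = y i.

Lemma open_agree (k : nat) (c : cantor_space) : open [set x | agree k x c].
Proof.
elim: k => [|k IHk].
  by rewrite (_ : mkset _ = setT); [exact: openT|apply/seteqP; split].
rewrite (_ : mkset _ =
    [set x | agree k x c] `&` (proj k : cantor_space -> bool) @^-1` [set c k]).
  apply: openI => //; apply: open_comp; last exact: discrete_open.
  by move=> x _; exact: proj_continuous.
apply/seteqP; split=> [x xc|x [xc xk] i].
  by split; [move=> i ik; apply: xc; exact: ltnW|exact: xc].
by rewrite ltnS leq_eqVlt => /predU1P[->|/xc].
Qed.

(** Lists stand for finite supports, so distinct codes may give the same point. *)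
Definition bits (s : nat) : cantor_space := fun i => i \in CodeSeq.decode s.

(** Membership of [x] in [1^k 0] is [agree k.+1 x (ones k)]: the extra coordinate is the final 0. *)
Definition ones (k : nat) : cantor_space := fun i => i < k.

Lemma ltn_decode (s k : nat) : s \in CodeSeq.decode k -> s < k.
Proof. by move=> sk; have /allP := CodeSeq.gtn_decode k; exact. Qed.

Lemma ltn_bits (s i : nat) : bits s i -> i < s.
Proof. exact: ltn_decode. Qed.

Lemma ones_bits (k : nat) : range bits (ones k).
Proof.
exists (CodeSeq.code (iota 0 k)) => //; apply/funext => i.
by rewrite /bits CodeSeq.codeK mem_iota.
Qed.

Lemma dense_bits : dense (range bits).
Proof.
move=> O [x Ox] openO.
(* Truncations of [x] to its first [n] coordinates; they converge to [x] pointwise. *)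
pose u n := bits (CodeSeq.code [seq i <- iota 0 n | x i]).
have ux : u n @[n --> \oo] --> x.
  apply/(@pointwise_cvgP nat bool) => i.
  change (u n i @[n --> \oo] --> x i); apply: cvg_near_cst.
  near=> n; rewrite /u /bits CodeSeq.codeK mem_filter mem_iota add0n.
  suff -> : i < n by rewrite leq0n !andbT.
  by near: n; exact: nbhs_infty_gt.
have [n _ /(_ n (leqnn n)) Oun] := ux _ (open_nbhs_nbhs (conj openO Ox)).
by exists (u n); split=> //; exists (CodeSeq.code [seq i <- iota 0 n | x i]).
Unshelve. all: by end_near. Qed.

(** * The closed graph on the Cantor space *)

(* The boxes [1^k 0] x [b|k] whose union, symmetrized, is the non-adjacency
   relation. *)
Definition separated (x y : cantor_space) : Prop :=
  exists k, agree k.+1 x (ones k) /\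
    exists2 s, s \in CodeSeq.decode k & agree k y (bits s).

(** The cylinders [1^k 0] are pairwise disjoint: coordinates [k'] and [k' - 1] of [ones k] force
    [k' = k]. *)
Lemma separated_ones (k : nat) (y : cantor_space) : separated (ones k) y ->
  exists2 s, s \in CodeSeq.decode k & agree k y (bits s).
Proof.
move=> [k' [kk' ex]]; suff <- : k' = k by [].
apply/eqP; rewrite eqn_leq; apply/andP; split.
  case: k' kk' {ex} => // k' kk'.
  by have := kk' k' (leqnSn _); rewrite /ones ltnSn => ->.
by have := kk' k' (ltnSn _); rewrite /ones ltnn => /negbT; rewrite -leqNgt.
Qed.

(** In a box of index [j + 1] the first factor has a 1 at coordinate [j] and the second a 0, because
    codes exceed their entries. Hence [k <= j]. *)
Lemma separated_ones_r (k : nat) (y : cantor_space) :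
  separated y (ones k) -> exists2 i, k <= i & y i.
Proof.
move=> [[|j] [yj [s sj sagree]]]; first by have := ltn_decode sj.
have := sagree j (ltnSn j); have -> : bits s j = false.
  apply/negbTE/negP => /ltn_bits js; have := leq_trans (ltn_decode sj) js.
  by rewrite ltnn.
move=> /negbT; rewrite /ones -leqNgt => kj; exists j => //.
by rewrite yj /ones ltnS.
Qed.

(** The factors of a box are disjoint: they differ at the last coordinate of the block of ones. *)
Lemma separated_irr (x : cantor_space) : ~ separated x x.
Proof.
move=> [[|k] [xk [s sk xs]]]; first by have := ltn_decode sk.
have := xs k (ltnSn k); rewrite xk // /ones ltnSn => /esym/ltn_bits.
by rewrite ltnNge -ltnS ltn_decode.
Qed.

Definition cantor_adj (x y : cantor_space) : Prop :=
  ~ separated x y /\ ~ separated y x.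

Lemma cantor_adj_refl (x : cantor_space) : cantor_adj x x.
Proof. by split; exact: separated_irr. Qed.

Lemma cantor_adj_sym (x y : cantor_space) : cantor_adj x y -> cantor_adj y x.
Proof. by case. Qed.

Definition cantor_graph : graph cantor_space :=
  Graph cantor_adj_refl cantor_adj_sym.

Lemma open_separated :
  open [set p : cantor_space * cantor_space | separated p.1 p.2].
Proof.
rewrite openE => -[x y] /= [k [xk [s sk ys]]].
exists ([set z | agree k.+1 z (ones k)], [set z | agree k z (bits s)]) => /=.
  by split; apply: open_nbhs_nbhs; split=> //; exact: open_agree.
by move=> [x' y'] /= [x'k y's]; exists k; split=> //; exists s.
Qed.

Lemma closed_cantor_graph : closed_graph cantor_graph.
Proof.
rewrite /closed_graph (_ : mkset _ =
    ~` ([set p | separated p.1 p.2] `|`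
        (fun p => (p.2, p.1)) @^-1` [set p | separated p.1 p.2])).
  apply: open_closedC; apply: openU; first exact: open_separated.
  apply: open_comp; last exact: open_separated.
  by move=> -[x y] _; exact: (filter.cvg_pair (f := snd) (g := fst) cvg_snd cvg_fst).
by rewrite setCU; apply/seteqP; split.
Qed.

(** The first factor of a box of index [k] has a 0 at coordinate [k], the second at [k - 1]. *)
Lemma adj_all_ones (x : cantor_space) : cantor_graph x (fun=> true).
Proof.
split=> [[[|k] [_ [s sk ys]]]|[k [/(_ k (ltnSn k))]]].
- by have := ltn_decode sk.
- have /esym/ltn_bits := ys k (ltnSn k).
  by rewrite ltnNge -ltnS ltn_decode.
- by rewrite /ones ltnn.
Qed.

(** An isolated [x] would equal 1 1 1 ..., which is also adjacent to the zero sequence [ones 0]. *)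
Lemma not_isolated_cantor_graph (x : cantor_space) :
  ~ isolated_vertex cantor_graph x.
Proof.
move=> isox; have x1 := isox _ (adj_all_ones x).
have /(congr1 (fun y : cantor_space => y 0)) : ones 0 = x.
  by apply: isox; apply: adj_sym; rewrite -x1; exact: adj_all_ones.
by rewrite -x1.
Qed.

(** * The extension property on the dense set *)

Lemma induced_bits_random : is_random_graph (induced cantor_graph (range bits)).
Proof.
have /choice[c cK] (d : range bits) : exists s, bits s = val d.
  by case: d => x /= /set_mem[s _ <-]; exists s.
split=> [|A B finA finB AB0].
  apply/countable_injP; exists c => d e _ _ /(congr1 bits).
  by rewrite !cK => /val_inj.
have /finite_seqP[t cBt] := finite_image c finB.
have /finite_seqP[r cAr] := finite_image c finA.
(* [m] bounds the chosen codes, so every point of [A] and [B] vanishes from coordinate [m] on. *)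
pose m := (\max_(i <- r ++ t) i).
have lem i : i \in r ++ t -> i <= m.
  by move=> ist; apply: (leq_bigmax_seq (F := id)).
have ct d : B d -> c d \in t.
  by move=> Bd; have : (c @` B) (c d) by [exists d]; rewrite cBt.
have cr d : A d -> c d \in r.
  by move=> Bd; have : (c @` A) (c d) by [exists d]; rewrite cAr.
have clem d : (A `|` B) d -> c d <= m.
  by move=> [/cr|/ct] h; apply: lem; rewrite mem_cat h ?orbT.
have vge d i : (A `|` B) d -> m <= i -> val d i = false.
  move=> /clem dm mi; rewrite -cK; apply/negbTE/negP => /ltn_bits.
  by rewrite ltnNge (leq_trans dm).
(* No point of A or B agrees with [bits q] below k, since [bits q m] is true. *)
pose q := CodeSeq.code [:: m]; pose k := CodeSeq.code (rcons t q).
have mk : m < k.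
  have mq : m < q by apply: ltn_decode; rewrite CodeSeq.codeK inE.
  apply: ltn_trans mq _; apply: ltn_decode.
  by rewrite CodeSeq.codeK mem_rcons mem_head.
exists (exist _ (ones k) (mem_set (ones_bits k))); split.
- by move=> /vge/(_ (leqnn m)) /=; rewrite /ones mk.
- move=> a Aa; have aAB : (A `|` B) a by left.
  (* Separation with [a] on the left needs a 1 of [a] at or beyond [k]. With [a] on the right,
     coordinate [m] excludes the dummy [q], and a code of some [b] in [B] would give [a = b]. *)
  split=> /= [/separated_ones[s]|/separated_ones_r[i ki]]; last first.
    by rewrite (vge _ _ aAB (leq_trans (ltnW mk) ki)).
  rewrite CodeSeq.codeK mem_rcons inE => /predU1P[->|].
    move=> /(_ m mk); rewrite (vge _ _ aAB (leqnn m)).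
    by rewrite /bits CodeSeq.codeK inE eqxx.
  move=> st; have : (c @` B) s by rewrite cBt.
  move=> [b Bb <-] ab; suff : (A `&` B) a by rewrite AB0.
  split=> //; suff -> : a = b by [].
  (* Agreement below [k] is equality, since both points vanish from [k] on. *)
  apply: val_inj; apply/funext => i; have [/ab|ki] := ltnP i k.
    by rewrite cK.
  have mi := leq_trans (ltnW mk) ki.
  by rewrite !vge //; right.
- move=> b Bb [nsep _]; apply: nsep; exists k; split=> //.
  exists (c b); last by rewrite cK.
  by rewrite CodeSeq.codeK mem_rcons inE ct ?orbT.
Qed.

(** * Back-and-forth between random graphs *)

(** A relation rather than a partial function, so that inverses and unions of chains are easy to
    form. *)
Definition finite_local_iso (V W : Type) (G : graph V) (H : graph W)
    (s : set (V * W)) : Prop :=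
  finite_set s /\ forall p q, s p -> s q ->
    (p.1 = q.1 <-> p.2 = q.2) /\ (G p.1 q.1 <-> H p.2 q.2).

Lemma finite_local_iso_forth (V W : Type) (G : graph V) (H : graph W)
    (s : set (V * W)) (x : V) :
  is_random_graph H -> finite_local_iso G H s ->
  exists t, [/\ finite_local_iso G H t, s `<=` t & exists y, t (x, y)].
Proof.
move=> [_ Hrand] sGH; have [fins siso] := sGH.
have [[y sxy]|xs] := pselect (exists y, s (x, y)).
  by exists s; split=> //; exists y.
(* The image of [x] must be adjacent to all of [A] and to none of [B]. *)
pose A := snd @` (s `&` [set p | G x p.1]).
pose B := snd @` (s `\` [set p | G x p.1]).
have finA : finite_set A by apply: finite_image; exact: finite_setIl.
have finB : finite_set B by apply: finite_image; exact: finite_setD.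
have [|y [yAB yA yB]] := Hrand _ _ finA finB.
  (* [A] and [B] are disjoint because [s] is injective. *)
  rewrite -subset0 => _ [[p [sp xp] <-] [q [sq xq] /= qp]].
  by apply: xq => /=; rewrite (siso _ _ sq sp).1.2.
have yadj p : s p -> G x p.1 <-> H y p.2.
  move=> sp; have [xp|xp] := pselect (G x p.1).
    by split=> // _; apply: yA; exists p.
  by split=> // yp; exfalso; apply: yB yp; exists p.
have xNs p : s p -> p.1 <> x.
  by case: p => a b sab /= ax; apply: xs; exists b; rewrite -ax.
have yNs p : s p -> p.2 <> y.
  move=> sp py; apply: yAB; rewrite -py.
  by have [xp|xp] := pselect (G x p.1); [left|right]; exists p.
exists ((x, y) |` s); split; last by exists y; left.
- split; first by rewrite finite_setU; split=> //; exact: finite_set1.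
  move=> p q [->|sp] [->|sq]; last exact: siso.
  + by split; split=> _ //; exact: adj_refl.
  + split; last exact: yadj.
    by split=> /= /esym ?; [case: (xNs _ sq)|case: (yNs _ sq)].
  + split=> /=; first by split=> ?; [case: (xNs _ sp)|case: (yNs _ sp)].
    by split=> /= ap; apply: adj_sym; apply/(yadj _ sp); exact: adj_sym.
- by move=> p sp; right.
Qed.

Lemma finite_local_iso_sym (V W : Type) (G : graph V) (H : graph W)
    (s : set (V * W)) :
  finite_local_iso G H s ->
  finite_local_iso H G ((fun p => (p.2, p.1)) @` s).
Proof.
move=> [fins siso]; split; first exact: finite_image.
by move=> _ _ [p sp <-] [q sq <-] /=; have [] := siso _ _ sp sq; tauto.
Qed.

(** The forth step, applied to the inverse relation. *)
Lemma finite_local_iso_back (V W : Type) (G : graph V) (H : graph W)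
    (s : set (V * W)) (y : W) :
  is_random_graph G -> finite_local_iso G H s ->
  exists t, [/\ finite_local_iso G H t, s `<=` t & exists x, t (x, y)].
Proof.
move=> Grand /finite_local_iso_sym sHG.
have [t [/finite_local_iso_sym tGH st [x tyx]]] :=
  finite_local_iso_forth y Grand sHG.
exists ((fun p => (p.2, p.1)) @` t); split=> //; last by exists x, (y, x).
by move=> [a b] sab; exists (b, a) => //; apply: st; exists (a, b).
Qed.

(** The requirements [P n] are met one at a time, starting from the empty relation. Any two pairs of
    the union already lie in a common stage. *)
Lemma finite_local_iso_chain (V W : Type) (G : graph V) (H : graph W)
    (P : nat -> set (V * W) -> Prop) :
  (forall n s, finite_local_iso G H s ->
     exists t, [/\ finite_local_iso G H t, s `<=` t & P n t]) ->
  exists u : set (V * W),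
    (forall p q, u p -> u q ->
       (p.1 = q.1 <-> p.2 = q.2) /\ (G p.1 q.1 <-> H p.2 q.2)) /\
    forall n, exists2 t, t `<=` u & P n t.
Proof.
move=> stepP.
have /choice[F FP] (ns : nat * set (V * W)) : exists t,
    finite_local_iso G H ns.2 ->
    [/\ finite_local_iso G H t, ns.2 `<=` t & P ns.1 t].
  have [/stepP-/(_ ns.1)[t tP]|//] := pselect (finite_local_iso G H ns.2).
    by exists t.
  (* Default value where [ns.2] is not a finite local isomorphism. *)
  by exists set0.
pose u := fix u n := if n is m.+1 then F (m, u m) else set0.
have uiso n : finite_local_iso G H (u n).
  by elim: n => [|n /(FP (n, _))[]//]; split=> //; exact: finite_set0.
have uS n : u n `<=` u n.+1 by case: (FP (n, u n) (uiso n)).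
have uP n : P n (u n.+1) by case: (FP (n, u n) (uiso n)).
have umono m n : m <= n -> u m `<=` u n.
  elim: n => [|n IHn]; first by rewrite leqn0 => /eqP->.
  rewrite leq_eqVlt ltnS => /predU1P[->//|/IHn mn].
  exact: subset_trans (uS n).
exists (\bigcup_n u n); split=> [p q [m _ up] [n _ uq]|n].
  apply: (uiso (maxn m n)).2.
    exact: umono (leq_maxl m n) _ up.
  exact: umono (leq_maxr m n) _ uq.
by exists (u n.+1) => //; exact: bigcup_sup.
Qed.

Lemma isomorphic_range (V W : Type) (G : graph V) (H : graph W) (f : V -> W) :
  injective f -> (forall x y, G x y <-> H (f x) (f y)) ->
  isomorphic G (induced H (range f)).
Proof.
move=> finj fadj.
have frange x : f x \in range f by apply/mem_set; exists x.
have /choice[g gK] (d : range f) : exists x, f x = val d.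
  by case: d => y /= /set_mem[x _ <-]; exists x.
exists (fun x => exist _ (f x) (frange x)); split=> //.
exists g => [x|d]; first by apply: finj; rewrite gK.
by apply: val_inj; rewrite /= gK.
Qed.

Lemma random_graph_isomorphic (V W : Type) (G : graph V) (H : graph W) :
  is_random_graph G -> is_random_graph H -> isomorphic G H.
Proof.
move=> Grand Hrand.
have /countable_injP[e einj] := Grand.1.
have /countable_injP[e' e'inj] := Hrand.1.
(* Requirement [n]: the vertices numbered [n] in [G] and in [H], where they exist, lie in the domain
   and in the range of [s]. *)
pose P n (s : set (V * W)) := (forall x, e x = n -> exists y, s (x, y)) /\
  (forall y, e' y = n -> exists x, s (x, y)).
have [n s sGH|u [uiso uP]] := @finite_local_iso_chain V W G H P.
  have [t [tGH st te]] : exists t, [/\ finite_local_iso G H t, s `<=` t &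
      forall x, e x = n -> exists y, t (x, y)].
    have [[x xn]|nx] := pselect (exists x, e x = n); last first.
      by exists s; split=> // x xn; case: nx; exists x.
    have [t [tGH st xt]] := finite_local_iso_forth x Hrand sGH.
    exists t; split=> // x'; rewrite -xn => /einj -> //; exact: in_setT.
  have [[y yn]|ny] := pselect (exists y, e' y = n); last first.
    by exists t; split=> //; split=> // y yn; case: ny; exists y.
  have [r [rGH tr yr]] := finite_local_iso_back y Grand tGH.
  exists r; split=> //; first exact: subset_trans tr.
  split=> [x /te[z /tr]|y']; first by exists z.
  rewrite -yn => /e'inj -> //; exact: in_setT.
have /choice[f uf] (x : V) : exists y, u (x, y).
  by have [t tu [/(_ x erefl)[y /tu]]] := uP (e x); exists y.
have /choice[g ug] (y : W) : exists x, u (x, y).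
  by have [t tu [_ /(_ y erefl)[x /tu]]] := uP (e' y); exists x.
exists f; split=> [|x y]; last by case: (uiso _ _ (uf x) (uf y)).
(* [f] and [g] are both read off from [u], which is injective and single-valued, so they are
   mutually inverse. *)
exists g => [x|y].
  by apply: (uiso _ _ (ug (f x)) (uf x)).1.2.
by apply: (uiso _ _ (uf (g y)) (ug y)).1.1.
Qed.

(** The forth half of the argument: each vertex of [G] enters the domain at the stage given by its
    number. *)
Lemma random_graph_universal (V W : Type) (G : graph V) (H : graph W) :
  countable_graph G -> is_random_graph H ->
  exists f : V -> W, injective f /\ forall x y, G x y <-> H (f x) (f y).
Proof.
move=> /countable_injP[e einj] Hrand.
pose P n (s : set (V * W)) := forall x, e x = n -> exists y, s (x, y).
have [n s sGH|u [uiso uP]] := @finite_local_iso_chain V W G H P.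
  have [[x xn]|nx] := pselect (exists x, e x = n); last first.
    by exists s; split=> // x xn; case: nx; exists x.
  have [t [tGH st xt]] := finite_local_iso_forth x Hrand sGH.
  exists t; split=> // x'; rewrite -xn => /einj -> //; exact: in_setT.
have /choice[f uf] (x : V) : exists y, u (x, y).
  by have [t tu /(_ x erefl)[y /tu]] := uP (e x); exists y.
exists f; split=> x y.
  by move=> /(uiso _ _ (uf x) (uf y)).1.2.
by case: (uiso _ _ (uf x) (uf y)).
Qed.

Theorem theorem7p4 :
  (exists G : graph cantor_space,
     [/\ closed_graph G,
         forall x : cantor_space, ~ isolated_vertex G x &
         forall (V : Type) (R : graph V), is_random_graph R ->
           exists D : set cantor_space,
             dense D /\ isomorphic R (induced G D)]) /\
  (forall (V : Type) (H : graph V), countable_graph H ->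
     exists G : graph cantor_space, closed_graph G /\ embeds H G).
Proof.
split=> [|V H Hcount].
  exists cantor_graph; split; first exact: closed_cantor_graph.
    exact: not_isolated_cantor_graph.
  move=> V R Rrand; exists (range bits); split; first exact: dense_bits.
  exact: random_graph_isomorphic induced_bits_random.
exists cantor_graph; split; first exact: closed_cantor_graph.
have [f [finj fadj]] := random_graph_universal Hcount induced_bits_random.
exists (range (val \o f)); apply: isomorphic_range => [x y /val_inj/finj//|x y].
exact: fadj.
Qed.
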